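(* Let $r\ge 1$ and $n\ge 1$ be integers and $0\le k\le n$. The number $A_{n,k}^{(r)}$ of $r$-colored Dyck paths of length $2n$ having exactly $k$ occurrences of two consecutive $\mathbf{d}$-steps with the same color is $$A_{n,k}^{(r)}=\sum_{\ell=1}^{n-k}\frac{1}{n}\binom{n}{\ell-1}\binom{n}{\ell}\binom{n-\ell}{k}r^{\ell}(r-1)^{n-\ell-k}.$$ In particular, the number $A_{n,0}^{(r)}$ of $r$-colored Dyck paths of length $2n$ with no two consecutive $\mathbf{d}$-steps having the same color equals $S_n(1,r-1)$, and for $r=2$ it equals the large Schröder number $S_n=S_n(1,1)$.
   Context: A Dyck path of length $2n$ is a lattice path from $(0,0)$ to $(2n,0)$ staying weakly above the $x$-axis, using $n$ up-steps $\mathbf{u}=(1,1)$ and $n$ down-steps $\mathbf{d}=(1,-1)$. An $r$-colored Dyck path is a Dyck path in which each $\mathbf{d}$-step is assigned one of the colors in $[r]=\{1,\dots,r\}$. A ''$\mathbf{dd}$-step with the same color'' is a pair of consecutive steps both of which are $\mathbf{d}$-steps and which carry the same color. For parameters $a,b$, $S_n(a,b)=\sum_{k=0}^{n}\binom{n+k}{2k}C_k a^{n-k}b^{k}$, where $C_k=\frac{1}{k+1}\binom{2k}{k}$ is the Catalan number (the total weight of Schröder paths of length $2n$ with horizontal steps weighted $a$ and down steps weighted $b$). *)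

(* Defs.v *)
From mathcomp Require Import all_boot all_order all_algebra.

Set Implicit Arguments.
Unset Strict Implicit.
Unset Printing Implicit Defensive.

Import Order.TTheory GRing.Theory Num.Theory.

Local Open Scope ring_scope.

(* [None] is the up-step (1,1); [Some c] is a down-step (1,-1) of color c.
   The color set {1, ..., r} is represented by 'I_r. *)
Notation step r := (option 'I_r).

Definition is_up (r : nat) (x : step r) : bool := ~~ isSome x.
Definition is_down (r : nat) (x : step r) : bool := isSome x.

(* A path from (0,0) is its word of steps; the endpoint of the word [s] is
   (size s, height s). *)
Definition height (r : nat) (s : seq (step r)) : int :=
  (count (@is_up r) s)%:Z - (count (@is_down r) s)%:Z.

Definition is_dyck (r n : nat) (s : seq (step r)) : bool :=
  [&& count (@is_up r) s == n, count (@is_down r) s == n, height s == 0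
    & all (fun i => 0 <= height (take i s)) (iota 0 (size s).+1)].

Definition same_color_dd (r : nat) (x y : step r) : bool :=
  match x, y with
  | Some c, Some c' => c == c'
  | _, _ => false
  end.

Definition num_same_color_dd (r : nat) (s : seq (step r)) : nat :=
  count (fun i => same_color_dd (nth None s i) (nth None s i.+1))
        (iota 0 (size s).-1).

Definition num_dyck_dd (r n k : nat) : nat :=
  #|[set p : (2 * n).-tuple (step r) |
      is_dyck n p && (num_same_color_dd p == k)]|.

Definition catalan (k : nat) : rat := (k.+1)%:R^-1 * 'C(2 * k, k)%:R.

Definition schroder_weight (n : nat) (a b : rat) : rat :=
  \sum_(0 <= k < n.+1) 'C(n + k, 2 * k)%:R * catalan k * a ^+ (n - k) * b ^+ k.

Definition large_schroder (n : nat) : rat := schroder_weight n 1 1.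

(* Main.v *)
(* Read a path from left to right, remembering the previous step: a down-step
   after an up-step has [r] colors and creates no pair, while a down-step after
   a down-step has total weight [y = X + (r - 1)], where [X] marks a pair of
   equal colors.  The resulting two-state recurrence in the numbers [u], [d] of
   remaining steps is solved by sums over the number [l] of descents of
   2x2 determinants of binomial coefficients times [r^l y^(d-l)]; for [u = d = n]
   the determinant is the Narayana number, and the coefficient of [X^k] is the
   formula.  For [k = 0], expanding [r^l = ((r-1) + 1)^l] and summing over [l]
   by Vandermonde gives the Schroeder weights. *)
Require Import Defs.
From mathcomp Require Import all_boot all_order all_algebra.
From mathcomp Require Import ring zify.

Import Order.TTheory GRing.Theory Num.Theory.

Local Open Scope ring_scope.

Lemma big_tupleS (V : nmodType) (T : finType) (m : nat) (F : seq T -> V) :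
  \sum_(p : m.+1.-tuple T) F p = \sum_x \sum_(p : m.-tuple T) F (x :: p).
Proof.
rewrite pair_bigA /= (reindex (fun q : T * m.-tuple T => [tuple of q.1 :: q.2])) //=.
exists (fun p => (thead p, [tuple of behead p])) => [[x p]|p] _ /=.
  by congr pair; apply: val_inj.
by rewrite -tuple_eta.
Qed.

(** * Closed forms for the two-state recurrence *)

Section ClosedForms.

Variables (R : comPzRingType) (a y : R).

Let B (m l : nat) : R := 'C(m, l)%:R.

(* [narayanaU] and [narayanaD] weigh the completions by [u] up- and [d]
   down-steps after an up-step, respectively after a down-step; in the latter
   case an immediate down-step does not start a new descent. *)
Definition narayanaU (u d : nat) : R :=
  if d is d'.+1 then
    \sum_(l < d) (B d' l * B u.+1 l.+1 - B d l * B u l.+1)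
                 * a ^+ l.+1 * y ^+ (d' - l)
  else (u == 0%N)%:R.

Definition narayanaD (u d : nat) : R :=
  if u is u'.+1 then
    \sum_(l < d.+1) (B d l * B u l - B d.+1 l * B u' l) * a ^+ l * y ^+ (d - l)
  else y ^+ d.

Let BS m l : B m.+1 l.+1 = B m l.+1 + B m l.
Proof. by rewrite /B binS natrD. Qed.

Lemma narayanaU0S d : narayanaU 0 d.+1 = a * y ^+ d.
Proof.
rewrite /narayanaU big_ord_recl big1 => [|i _] /=; last first.
  by rewrite /B /bump /= 2?(@bin_small _ i.+2) // !mulr0 subr0 !mul0r.
by rewrite /B /= !bin0 bin0n subn0 /= mulr0 subr0 addr0 !mul1r expr1.
Qed.

(** The two products in each determinant coincide. This is the boundary value just below the axis,
    where no completion is allowed. *)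
Lemma narayanaD_diag d : narayanaD d.+1 d = 0.
Proof.
by rewrite /narayanaD big1 // => i _; rewrite [B d i * _]mulrC subrr !mul0r.
Qed.

Lemma narayanaUS u d :
  narayanaU u.+1 d.+1 = narayanaU u d.+1 + a * narayanaD u.+1 d.
Proof.
rewrite /narayanaU /narayanaD big_distrr -big_split /=; apply: eq_bigr => l _.
rewrite (BS u.+1) (BS u) exprS; ring.
Qed.

Lemma narayanaDS u d : (u <= d)%N ->
  narayanaD u.+1 d.+1 = narayanaU u d.+1 + y * narayanaD u.+1 d.
Proof.
move=> le_ud; rewrite /narayanaU /narayanaD.
rewrite big_ord_recl /= /B !bin0 subrr !mul0r add0r.
(* The term [l = 0] vanishes, so the index shifts by one; the new top term vanishes because both [d]
   and [u] are below [d.+1], which uses [u <= d]. *)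
have -> : y * (\sum_(l < d.+1) (B d l * B u.+1 l - B d.+1 l * B u l)
                 * a ^+ l * y ^+ (d - l))
   = \sum_(l < d.+1) (B d l.+1 * B u.+1 l.+1 - B d.+1 l.+1 * B u l.+1)
                 * a ^+ l.+1 * y ^+ (d - l).
  rewrite big_ord_recl /= /B !bin0 subrr !mul0r add0r big_ord_recr /=.
  rewrite (@bin_small d d.+1) // (@bin_small u d.+1) //.
  rewrite mul0r mulr0 subr0 !mul0r addr0.
  rewrite big_distrr; apply: eq_bigr => i _ /=.
  rewrite /bump /= add1n -[in RHS](subnSK (ltn_ord i)) [y ^+ _.+1]exprS; ring.
rewrite -big_split /=; apply: eq_bigr => l _.
rewrite /B /bump /= add1n subSS !binS !natrD; ring.
Qed.

End ClosedForms.

(** * Colored ballot words and their generating polynomial *)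

Section Paths.

Variable r : nat.
Implicit Types (s : seq (step r)) (x : step r).

(* A word of [u] up- and [d] down-steps ending on the x-axis starts at height
   [d - u], so staying weakly above the axis means that [u <= d] holds for the
   numbers of remaining steps at every moment. *)
Fixpoint ballot (u d : nat) s : bool :=
  match s with
  | [::] => (u == 0%N) && (d == 0%N)
  | None :: s' => if u is u'.+1 then ballot u' d s' else false
  | Some _ :: s' => if d is d'.+1 then (u <= d')%N && ballot u d' s' else false
  end.

Lemma heightS x s : height (x :: s) = (if x is None then 1 else -1) + height s.
Proof. by rewrite /height; case: x => [c|] /=; rewrite ?add0n ?add1n; lia. Qed.

Lemma height_nil : @height r [::] = 0. Proof. by []. Qed.

Lemma ballotE u d s : (u <= d)%N ->
  [&& count (@is_up r) s == u, count (@is_down r) s == d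
    & all (fun i => 0 <= d%:Z - u%:Z + height (take i s)) (iota 0 (size s).+1)]
  = ballot u d s.
Proof.
elim: s u d => [|x s IHs] u d le_ud.
  rewrite /= height_nil andbT addr0 [0%N == u]eq_sym [0%N == d]eq_sym.
  by case: eqP => // _; case: eqP => // _; rewrite subr_ge0 lez_nat le_ud.
have -> : iota 0 (size (x :: s)).+1 = 0%N :: [seq i.+1 | i <- iota 0 (size s).+1].
  by rewrite (eq_map (fun i => esym (add1n i))) -iotaDl.
(* Hiding the index list behind [t] keeps simplification from unfolding it. *)
have [t Et] : {t | t = iota 0 (size s).+1} by exists (iota 0 (size s).+1).
rewrite -Et in IHs *.
rewrite /= all_map height_nil addr0 subr_ge0 lez_nat le_ud /=.
under eq_all => i do rewrite /= heightS.
case: x => [c|] /=; rewrite ?add0n ?add1n.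
  case: d le_ud => [|d] le_ud; first by rewrite andbF.
  rewrite eqSS; case: leqP => [le_ud'|lt_du] /=; last first.
    (* The down-step just read already ends below the axis. *)
    rewrite Et /= take0 height_nil addr0; apply/negP => /and4P[_ _]; lia.
  rewrite -IHs //; congr [&& _, _ & _]; apply: eq_all => i.
  congr (0 <= _); lia.
case: u le_ud => [|u] le_ud; first by [].
rewrite eqSS -IHs; last exact: ltnW.
congr [&& _, _ & _]; apply: eq_all => i.
congr (0 <= _); lia.
Qed.

Lemma is_dyckE n s : is_dyck n s = ballot n n s.
Proof.
rewrite -ballotE // /is_dyck subrr.
under [in RHS]eq_all do rewrite add0r.
by case: eqP => // eq_up; case: eqP => // eq_dn; rewrite /height eq_up eq_dn subrr.
Qed.

Lemma num_same_color_ddS x x' s :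
  num_same_color_dd [:: x, x' & s]
  = (same_color_dd x x' + num_same_color_dd (x' :: s))%N.
Proof.
rewrite /num_same_color_dd /= -[1%N]addn0 iotaDl count_map /=.
by congr addn.
Qed.

Lemma num_same_color_dd_None s :
  num_same_color_dd (None :: s) = num_same_color_dd s.
Proof. by case: s => // x s; rewrite num_same_color_ddS. Qed.

(** Here [x] is the step read just before the word. [None] also serves for the start of a path,
    since a preceding up-step creates no pair. *)
Definition dd_poly (m u d : nat) x : {poly rat} :=
  \sum_(p : m.-tuple (step r)) (ballot u d p)%:R * 'X^(num_same_color_dd (x :: p)).

Let a : {poly rat} := r%:R.
Let y : {poly rat} := 'X + (r%:R - 1)%:P.

Lemma sum_same_color x :
  \sum_(c < r) 'X^(same_color_dd x (Some c)) = if x is None then a else y.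
Proof.
case: x => [c|] /=; last by rewrite sumr_const card_ord.
rewrite (bigD1 c) //= eqxx expr1; congr (_ + _).
rewrite (eq_bigr (fun=> 1)) => [|i /negPf]; last by rewrite eq_sym => ->.
rewrite sumr_const cardC1 card_ord polyCB rmorph_nat.
by case: r c => [[]//|n] _; rewrite -natr1 addrK.
Qed.

Lemma dd_polyS m u d x :
  dd_poly m.+1 u d x
  = (if u is u'.+1 then dd_poly m u' d None else 0)
    + (if d is d'.+1 then (u <= d')%:R *
         \sum_(c < r) 'X^(same_color_dd x (Some c)) * dd_poly m u d' (Some c) else 0).
Proof.
rewrite /dd_poly (@big_tupleS _ _ _ (fun p =>
  (ballot u d p)%:R * 'X^(num_same_color_dd (x :: p)))) /=.
rewrite (bigD1 None) //=; congr (_ + _).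
  case: u => [|u]; first by rewrite big1 // => p _; rewrite mul0r.
  by apply: eq_bigr => p _; rewrite num_same_color_ddS; case: x.
rewrite (reindex_omap Some id) => [|[]//] /=.
under eq_bigl do rewrite eqxx.
case: d => [|d].
  by rewrite big1 // => c _; rewrite big1 // => p _; rewrite mul0r.
rewrite big_distrr; apply: eq_bigr => c _ /=.
rewrite !big_distrr; apply: eq_bigr => p _ /=.
by rewrite num_same_color_ddS exprD -mulnb natrM; ring.
Qed.

(** Induction on the length: both sides obey the same recurrence, and the color of a preceding
    down-step does not affect the total. *)
Lemma dd_polyE m u d x : (u <= d)%N -> m = (u + d)%N ->
  dd_poly m u d x = if x is None then narayanaU _ a y u d else narayanaD _ a y u d.
Proof.
elim: m u d x => [|m IHm] u d x le_ud.
  case: u d le_ud => [|u] [|d] // _ _.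
  rewrite /dd_poly (eq_bigr (fun=> 1)) => [|p _]; last by rewrite tuple0 /= mul1r.
  by rewrite sumr_const card_tuple expn0 mulr1n; case: x.
case: d le_ud => [|d] le_ud eq_m; first by case: u le_ud eq_m.
rewrite dd_polyS.
have {}eq_m : m = (u + d)%N by lia.
have -> : (u <= d)%:R * (\sum_(c < r) 'X^(same_color_dd x (Some c))
             * dd_poly m u d (Some c))
          = (if x is None then a else y) * narayanaD _ a y u d.
  case: leqP => [le_ud'|lt_du]; last first.
    have ->: u = d.+1 by lia.
    by rewrite narayanaD_diag mul0r mulr0.
  rewrite mul1r -sum_same_color big_distrl; apply: eq_bigr => c _ /=.
  by rewrite (IHm u d).
case: u le_ud eq_m => [|u] le_ud eq_m.
  by rewrite add0r; case: x => [c|]; rewrite ?narayanaU0S //= exprS.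
rewrite (IHm u d.+1) //; [|exact: ltnW|lia].
by case: x => [c|]; rewrite ?narayanaUS ?narayanaDS.
Qed.

Lemma num_dyck_ddE n k : (num_dyck_dd r n k)%:R = (narayanaU _ a y n n)`_k.
Proof.
rewrite -(@dd_polyE (2 * n) n n None) //; last lia.
rewrite /dd_poly coef_sum /num_dyck_dd -sum1_card natr_sum big_mkcond /=.
apply: eq_bigr => p _; rewrite inE is_dyckE num_same_color_dd_None.
rewrite mulr_natl coefMn coefXn eq_sym.
by case: ballot; case: eqP.
Qed.

End Paths.

(** * Coefficient extraction and Narayana numbers *)

Lemma coef_XaddC_exp (R : nzRingType) (c : R) (m k : nat) :
  (('X + c%:P) ^+ m)`_k = 'C(m, k)%:R * c ^+ (m - k).
Proof.
rewrite addrC exprDn_comm; last exact: commr_polyX.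
rewrite coef_sum.
under eq_bigr => i _ do rewrite -polyC_exp coefMn coefCM coefXn.
case: (ltnP k m.+1) => [lt_km|lt_mk].
  rewrite (bigD1 (Ordinal lt_km)) //= eqxx mulr1 big1 ?addr0 ?mulr_natl // => i.
  by rewrite -val_eqE /= eq_sym => /negPf->; rewrite mulr0 mul0rn.
rewrite bin_small // mul0r big1 // => i _; case: eqP => [eq_ki|]; last by rewrite mulr0 mul0rn.
by move: lt_mk; rewrite eq_ki ltnNge -ltnS ltn_ord.
Qed.

(** By absorption the first product is [n.+2 / n.+1] times the second, so the difference leaves the
    factor [1 / n.+1]. *)
Lemma narayana_det (n l : nat) :
  'C(n, l)%:R * 'C(n.+2, l.+1)%:R - 'C(n.+1, l)%:R * 'C(n.+1, l.+1)%:R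
  = n.+1%:R^-1 * 'C(n.+1, l)%:R * 'C(n.+1, l.+1)%:R :> rat.
Proof.
have nz m : m.+1%:R != 0 :> rat by rewrite pnatr_eq0.
have e1 : n.+1%:R * 'C(n, l)%:R = l.+1%:R * 'C(n.+1, l.+1)%:R :> rat.
  by rewrite -!natrM mul_bin_diag.
have e2 : n.+2%:R * 'C(n.+1, l)%:R = l.+1%:R * 'C(n.+2, l.+1)%:R :> rat.
  by rewrite -!natrM mul_bin_diag.
have f1 : 'C(n, l)%:R = l.+1%:R * 'C(n.+1, l.+1)%:R / n.+1%:R :> rat.
  by rewrite -e1 mulrAC mulfV // mul1r.
have f2 : 'C(n.+2, l.+1)%:R = n.+2%:R * 'C(n.+1, l)%:R / l.+1%:R :> rat.
  by rewrite e2 mulrAC mulfV // mul1r.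
rewrite f1 f2 -[n.+2%:R]natr1.
have := nz n; have := nz l.
move: (n.+1%:R) (l.+1%:R) => N L hL hN; field; by rewrite hL hN.
Qed.

Lemma num_dyck_dd_narayana (r n k : nat) : (1 <= n)%N -> (k <= n)%N ->
     (num_dyck_dd r n k)%:R =
       \sum_(1 <= l < (n - k).+1)
         n%:R^-1 * 'C(n, l.-1)%:R * 'C(n, l)%:R * 'C(n - l, k)%:R
         * r%:R ^+ l * (r%:R - 1) ^+ (n - l - k) :> rat.
Proof.
case: n => // n _ le_kn; rewrite num_dyck_ddE /narayanaU coef_sum.
rewrite big_add1 /= big_mkord (big_ord_widen n.+1 (fun l =>
         n.+1%:R^-1 * 'C(n.+1, l)%:R * 'C(n.+1, l.+1)%:R * 'C(n.+1 - l.+1, k)%:R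
         * r%:R ^+ l.+1 * (r%:R - 1) ^+ (n.+1 - l.+1 - k))) ?leq_subr //.
rewrite [RHS]big_mkcond /=; apply: eq_bigr => l _.
have -> : ('C(n, l)%:R * 'C(n.+2, l.+1)%:R - 'C(n.+1, l)%:R * 'C(n.+1, l.+1)%:R)
          * r%:R ^+ l.+1
  = (n.+1%:R^-1 * 'C(n.+1, l)%:R * 'C(n.+1, l.+1)%:R * r%:R ^+ l.+1)%:P
  :> {poly rat}.
  by rewrite -narayana_det !(rmorphM, rmorphB, rmorphXn, rmorph_nat).
rewrite coefCM coef_XaddC_exp subSS; case: ifP => [_|lt_kl].
  ring.
(* Beyond the stated range [n - l < k], so these terms are zero. *)
by rewrite (@bin_small (n - l)) ?mul0r ?mulr0 //; have := ltn_ord l; lia.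
Qed.

(** * From Narayana sums to Schroder weights *)

Lemma narayana_schroder (n k : nat) : (k <= n.+1)%N ->
  n.+1%:R^-1 * 'C(n.+1, k)%:R * 'C(n.+1 + k, n)%:R
  = 'C(n.+1 + k, 2 * k)%:R * catalan k :> rat.
Proof.
move=> le_kn; rewrite /catalan.
have nz m : m`!%:R != 0 :> rat by rewrite pnatr_eq0 -lt0n fact_gt0.
have binE p q : (q <= p)%N -> 'C(p, q)%:R = p`!%:R / (q`!%:R * (p - q)`!%:R) :> rat.
  move=> le_qp; rewrite -(bin_fact le_qp) !natrM mulfK //.
  by rewrite mulf_neq0.
rewrite !binE; try lia.
have -> : (n.+1 + k - n = k.+1)%N by lia.
have -> : (n.+1 + k - 2 * k = n.+1 - k)%N by lia.
have -> : (2 * k - k = k)%N by lia.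
rewrite !factS !natrM.
have := nz n; have := nz k; have := nz (n.+1 - k)%N; have := nz (2 * k)%N.
have : n.+1%:R != 0 :> rat by rewrite pnatr_eq0.
have : k.+1%:R != 0 :> rat by rewrite pnatr_eq0.
move: (n.+1%:R) (k.+1%:R) (n`!%:R) (k`!%:R) ((n.+1 - k)`!%:R) ((2 * k)`!%:R) => *.
field.
by do !(apply/andP; split).
Qed.

(** Trinomial revision, with the last binomial complemented to suit Vandermonde. *)
Lemma bin_trinomial (n l m : nat) : (m <= l <= n)%N ->
  ('C(n, l) * 'C(l, m) = 'C(n, m) * 'C(n - m, n - l))%N.
Proof.
case/andP=> le_ml le_ln; have le_mn := leq_trans le_ml le_ln.
apply/eqP; rewrite -(eqn_pmul2r (fact_gt0 m)) -(eqn_pmul2r (fact_gt0 (l - m))).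
rewrite -(eqn_pmul2r (fact_gt0 (n - l))); apply/eqP.
transitivity n`!.
  by rewrite -(bin_fact le_ln) -(bin_fact le_ml); ring.
have le' : (n - l <= n - m)%N by lia.
rewrite -(bin_fact le_mn) -(bin_fact le').
have -> : (n - m - (n - l) = l - m)%N by lia.
ring.
Qed.

Lemma sum_narayana_schroder (n : nat) (x : rat) :
  \sum_(l < n.+1) n.+1%:R^-1 * 'C(n.+1, l)%:R * 'C(n.+1, l.+1)%:R
     * (x + 1) ^+ l.+1 * x ^+ (n - l)
  = schroder_weight n.+1 1 x.
Proof.
transitivity (\sum_(l < n.+1) \sum_(m < n.+2)
   n.+1%:R^-1 * ('C(n.+1, l) * ('C(n.+1, l.+1) * 'C(l.+1, m)))%:R
   * x ^+ (n.+1 - m)).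
  apply: eq_bigr => l _; rewrite exprDn.
  rewrite (big_ord_widen n.+2
             (fun i => x ^+ (l.+1 - i) * 1 ^+ i *+ 'C(l.+1, i)));
    last by rewrite ltnS ltn_ord.
  rewrite big_mkcond big_distrr big_distrl; apply: eq_bigr => m _ /=.
  case: ltnP => [le_ml|lt_lm]; last first.
    by rewrite (bin_small lt_lm) !muln0 !(mulr0, mul0r).
  have -> : (n.+1 - m = (l.+1 - m) + (n - l))%N by have := ltn_ord l; lia.
  by rewrite exprD expr1n -mulr_natl !natrM; ring.
(* Reversing [m] to [k = n.+1 - m] makes the exponent of [x] equal to [k]. *)
rewrite exchange_big (reindex_inj rev_ord_inj) /schroder_weight big_mkord /=.
apply: eq_bigr => k _; rewrite subSS -big_distrl expr1n mulr1 -big_distrr -natr_sum /=.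
have le_kn : (k <= n.+1)%N by rewrite -ltnS.
rewrite (subKn le_kn); congr (_ * _).
rewrite -narayana_schroder // -mulrA -natrM; congr (_ * _%:R).
rewrite -binomial.Vandermonde big_distrr /=.
apply: eq_bigr => l _.
have le_ln : (l <= n)%N by rewrite -ltnS.
(* In the second case [k < n - l], and both sides vanish. *)
case: (leqP (n.+1 - k) l.+1) => [le|lt].
  rewrite bin_trinomial; last by rewrite le.
  by rewrite bin_sub // subKn // subSS; ring.
by rewrite (bin_small lt) (@bin_small k) ?muln0 //; lia.
Qed.

Theorem theorem2p1 (r n : nat) (hr : (1 <= r)%N) (hn : (1 <= n)%N) :
  (forall k : nat, (k <= n)%N ->
     (num_dyck_dd r n k)%:R =
       \sum_(1 <= l < (n - k).+1)
         n%:R^-1 * 'C(n, l.-1)%:R * 'C(n, l)%:R * 'C(n - l, k)%:R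
         * r%:R ^+ l * (r%:R - 1) ^+ (n - l - k) :> rat)
  /\ (num_dyck_dd r n 0)%:R = schroder_weight n 1 (r%:R - 1)
  /\ (r = 2%N -> (num_dyck_dd r n 0)%:R = large_schroder n).
Proof.
have schroderE : (num_dyck_dd r n 0)%:R = schroder_weight n 1 (r%:R - 1).
  rewrite num_dyck_dd_narayana // subn0; case: n hn => // n' _.
  rewrite -sum_narayana_schroder big_add1 big_mkord; apply: eq_bigr => l _.
  by rewrite bin0 mulr1 subSS subn0 subrK.
split=> [k le_kn|]; first exact: num_dyck_dd_narayana.
split=> // r2; rewrite schroderE r2; congr (schroder_weight n 1 _); ring.
Qed.
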